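(* Let $\mathcal M$ be a class of martingales $(M_k)_{k\ge0}$ with $M_0=0$, and let $x\in\mathbb R$. If $\mathcal M$ is closed under stopping at level $x$, then for every $n\ge 0$ $$B_n(x)=B_n^\ast(x),$$ where $$B_n(x)=\sup_{M\in\mathcal M}\mathbb P\{M_n\ge x\},\qquad B_n^\ast(x)=\sup_{M\in\mathcal M}\mathbb P\Big\{\max_{0\le k\le n}M_k\ge x\Big\}.$$
   Context: For a martingale $M=(M_k)$ with $M_0=0$ let $\tau_x=\min\{k: M_k\ge x\}$ (with value $+\infty$ if there is no such $k$). The class $\mathcal M$ is closed under stopping at level $x$ if, whenever $M=(M_k)_{k}\in\mathcal M$, the stopped martingale $(M_{\tau_x\wedge k})_{k}$ also belongs to $\mathcal M$, where $a\wedge b=\min\{a,b\}$. *)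

(* Defs.v *)
From HB Require Import structures.
From mathcomp Require Import all_boot all_order all_algebra.
From mathcomp Require Import all_classical all_reals all_analysis.

Set Implicit Arguments.
Unset Strict Implicit.
Unset Printing Implicit Defensive.

Import Order.TTheory GRing.Theory Num.Theory.

Local Open Scope classical_set_scope.
Local Open Scope ring_scope.

(* The probability space is part of the data, so that two members of a class
   of processes may live on different spaces. *)
Record process (R : realType) := Process {
  proc_disp : measure_display ;
  proc_space : measurableType proc_disp ;
  proc_prob : probability proc_space R ;
  proc_fun :> nat -> proc_space -> R }.

Definition filtration d (T : measurableType d) (F : nat -> set (set T)) : Prop :=
  [/\ forall k, sigma_algebra setT (F k),
      forall k, F k `<=` measurable &
      forall j k, (j <= k)%N -> F j `<=` F k].

Definition measurable_wrt d (T : measurableType d) (R : realType)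
    (G : set (set T)) (X : T -> R) : Prop :=
  forall B : set R, measurable B -> G (X @^-1` B).

(* Y is a version of E[X | G]. *)
Definition is_cond_exp d (T : measurableType d) (R : realType)
    (P : probability T R) (G : set (set T)) (X Y : T -> R) : Prop :=
  [/\ measurable_wrt G Y,
      P.-integrable setT (EFin \o Y) &
      forall A, G A ->
        (\int[P]_(t in A) (Y t)%:E = \int[P]_(t in A) (X t)%:E)%E].

Definition martingale_wrt d (T : measurableType d) (R : realType)
    (P : probability T R) (F : nat -> set (set T)) (M : nat -> T -> R) : Prop :=
  [/\ filtration F,
      forall k, measurable_wrt (F k) (M k),
      forall k, P.-integrable setT (EFin \o M k) &
      forall k, is_cond_exp P (F k) (M k.+1) (M k)].

(* The filtration is not part of the data of a martingale: the process is
   required to be a martingale for some filtration (equivalently, for its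
   natural one). *)
Definition martingale (R : realType) (M : process R) : Prop :=
  exists F, martingale_wrt (proc_prob M) F M.

(* tau_x = min {k : M_k >= x}, with None standing for +oo. *)
Definition hitting_time (R : realType) (M : process R) (x : R)
    (t : proc_space M) : option nat :=
  match pselect (exists k, x <= M k t) with
  | left h => Some (ex_minn h)
  | right _ => None
  end.

(* a /\ k for a in {0, 1, ..., +oo}, again with None = +oo. *)
Definition time_min (a : option nat) (k : nat) : nat :=
  if a is Some j then minn j k else k.

Definition stopped (R : realType) (x : R) (M : process R) : process R :=
  Process (proc_prob M)
    (fun k t => M (time_min (hitting_time x t) k) t).

(* A class of processes is a plain predicate: [set (process R)] is rejected by
   the universe constraints of the library (so is an image set indexed by it). *)
Definition closed_under_stopping (R : realType)
    (C : process R -> Prop) (x : R) : Prop :=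
  forall M, C M -> C (stopped x M).

(* Suprema are taken in the extended reals, hence are always meaningful. *)
Definition B (R : realType) (C : process R -> Prop) (n : nat) (x : R) : \bar R :=
  ereal_sup [set p | exists2 M, C M & p = proc_prob M [set t | x <= M n t]].

(* The default value M_0 of the iterated maximum is one of its terms, so it does
   not affect the result. *)
Definition Bstar (R : realType) (C : process R -> Prop) (n : nat) (x : R) : \bar R :=
  ereal_sup [set p | exists2 M, C M &
    p = proc_prob M [set t | x <= \big[Num.max/M 0%N t]_(0 <= k < n.+1) M k t]].

(* Main.v *)
(** The stopped martingale satisfies [M_(tau_x /\ n) >= x] exactly when some
    [M_k] with [k <= n] reaches [x], so the maximal event of [M] is the terminal
    event of a member of the class.  The other inequality is monotonicity of
    the probability. *)
Require Import Defs.
From HB Require Import structures.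
From mathcomp Require Import all_boot all_order all_algebra.
From mathcomp Require Import all_classical all_reals all_analysis.

Import Order.TTheory.

Lemma le_bigmax_headP (R : realType) (f : nat -> R) (x : R) (n : nat) :
  (x <= \big[Num.max/f 0%N]_(0 <= k < n.+1) f k)%R <->
  (exists2 k, (k <= n)%N & (x <= f k)%R).
Proof.
rewrite big_mkord; split=> [xmax|[k kn xfk]]; last first.
  rewrite -ltnS in kn; apply: (le_trans xfk).
  exact: (le_bigmax _ _ (Ordinal kn)).
apply: contrapT => noreach.
have below k : (k <= n)%N -> (f k < x)%R.
  move=> kn; rewrite ltNge; apply/negP => xfk.
  by apply: noreach; exists k.
move: xmax; rewrite leNgt => /negP; apply.
(* [bigmax_ltP] also asks that the default value be below [x]; here that value is the term of index
   0, so [below] covers it. *)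
apply/bigmax_ltP; split; first exact: below.
by move=> i _; apply: below; rewrite -ltnS.
Qed.

(** The stopped value is always some [M j t] with [j <= n], and once the level has been reached it
    stays frozen at the first value that is at least [x]. *)
Lemma stopped_geP (R : realType) (M : process R) (x : R) (n : nat)
    (t : proc_space M) :
  (x <= stopped x M n t)%R <-> (exists2 k, (k <= n)%N & (x <= M k t)%R).
Proof.
rewrite /= /hitting_time; case: pselect => [reach|noreach] /=.
  case: ex_minnP => m xMm mmin; split=> [xM|[k kn xMk]].
    by exists (minn m n); first exact: geq_minr.
  (* Minimality gives [m <= k <= n], so the process has already stopped at [m]. *)
  by rewrite (minn_idPl (leq_trans (mmin _ xMk) kn)).
(* With infinite hitting time the stopped value is [M n t], so both sides would contradict
   [noreach]. *)
split=> [xM|[k _ xMk]]; first by exists n.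
by case: noreach; exists k.
Qed.

Lemma martingale_measurable_ge (R : realType) (M : process R) (x : R) (k : nat) :
  martingale M -> measurable [set t | (x <= M k t)%R]%classic.
Proof.
move=> [F [[_ Fmeas _] adapted _ _]].
suff -> : [set t | (x <= M k t)%R]%classic = (M k @^-1` `[x, +oo[)%classic.
  by apply/(Fmeas k)/adapted; exact: measurable_itv.
by apply/seteqP; split=> t /=; rewrite in_itv /= andbT.
Qed.

(** The maximal event is a finite union of the events of the previous lemma; its measurability
    serves the monotonicity of the probability. *)
Lemma martingale_measurable_max_ge (R : realType) (M : process R) (x : R)
    (n : nat) :
  martingale M ->
  measurable
    [set t | (x <= \big[Num.max/M 0%N t]_(0 <= k < n.+1) M k t)%R]%classic.
Proof.
move=> Mmart.
suff -> : [set t | (x <= \big[Num.max/M 0%N t]_(0 <= k < n.+1) M k t)%R]%classic =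
    (\bigcup_(k in `I_n.+1) [set t | (x <= M k t)%R])%classic.
  by apply: bigcup_measurable => k _; exact: martingale_measurable_ge.
apply/seteqP; split=> t.
  by move=> /(le_bigmax_headP _ (M ^~ t) x n) [k kn xMk]; exists k.
by move=> [k kn xMk]; apply/(le_bigmax_headP _ (M ^~ t) x n); exists k.
Qed.

Theorem theorem3 (R : realType) (C : process R -> Prop) (x : R)
  (hmart : forall M : process R, C M -> martingale M)
  (h0 : forall M : process R, C M -> forall t : proc_space M, M 0%N t = 0%R)
  (hstop : closed_under_stopping C x) (n : nat) :
  B C n x = Bstar C n x.
Proof.
apply/eqP; rewrite eq_le; apply/andP; split.
  apply: ge_ereal_sup => _ [M CM ->].
  apply: (@le_trans _ _ (proc_prob M
    [set t | (x <= \big[Num.max/M 0%N t]_(0 <= k < n.+1) M k t)%R]%classic)).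
    apply: le_measure; rewrite ?inE.
    - by apply: martingale_measurable_ge; exact: hmart.
    - by apply: martingale_measurable_max_ge; exact: hmart.
    - by move=> t xM; apply/(le_bigmax_headP _ (M ^~ t) x n); exists n.
  by apply: ereal_sup_ubound; exists M.
apply: ge_ereal_sup => _ [M CM ->].
apply: ereal_sup_ubound; exists (stopped x M); first exact: hstop.
(* Stopping keeps the probability space, so it suffices that the two events agree as sets. *)
congr (proc_prob M _); apply/seteqP; split=> t.
  by move=> /(le_bigmax_headP _ (M ^~ t) x n) reach; apply/stopped_geP.
by move=> /stopped_geP reach; apply/(le_bigmax_headP _ (M ^~ t) x n).
Qed.
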